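(* Let $X,Y$ be separable strictly monotone real sequence spaces with normalized 1-unconditional bases $\{e_k\}_{k=1}^d$ and $\{f_k\}_{k=1}^d$, respectively, where $\dim X=\dim Y=d\ge3$ ($d\le\infty$). Suppose that either (a) $X$ and $Y$ are one-$p$-convex for some $2<p<\infty$, or (b) $X$ and $Y$ are one-$q$-concave for some $1<q<2$, and each of $X$, $Y$ is smooth at each of its basic vectors. Then any isometry $U$ from $X$ onto $Y$ is of the form $$U\Big(\sum_{k=1}^d a_ke_k\Big)=\sum_{k=1}^d\varepsilon_ka_kf_{\sigma(k)},$$ where $\sigma$ is a permutation of $\{1,\dots,d\}$ and $\varepsilon_k=\pm1$ for $k=1,\dots,d$.
   Context: All spaces are real and isometries are linear. A sequence space is a Banach space with a 1-unconditional basis $\{e_i\}_{i=1}^d$ ($d\le\infty$; if $d=\infty$ the index set is $\mathbb{N}$): a (Schauder) basis such that $\|\sum_i\varepsilon_i a_ie_i\|=\|\sum_i a_ie_i\|$ for all $\sum_i a_ie_i$ in the space and all signs $\varepsilon_i=\pm1$. Normalized means all basis vectors have norm one. Elements are identified with their coordinate sequences; order, absolute value and powers are coordinatewise. The space is strictly monotone if $|x|\le|y|$ and $|x|\ne|y|$ imply $\|x\|<\|y\|$. $X$ is one-$p$-convex ($1\le p<\infty$) if for every finite choice $x_1,\dots,x_m\in X$, $\|(\sum_{i=1}^m|x_i|^p)^{1/p}\|\le(\sum_{i=1}^m\|x_i\|^p)^{1/p}$. $X$ is one-$q$-concave ($1\le q<\infty$) if for every finite choice $x_1,\dots,x_m\in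 X$, $\|(\sum_{i=1}^m|x_i|^q)^{1/q}\|\ge(\sum_{i=1}^m\|x_i\|^q)^{1/q}$. $X$ is smooth at $x\ne0$ if there is exactly one norm-one functional $f\in X^*$ with $f(x)=\|x\|$. *)

(* Defs.v *)
From HB Require Import structures.
From mathcomp Require Import all_boot all_order all_algebra.
From mathcomp Require Import all_classical all_reals all_analysis.

Set Implicit Arguments.
Unset Strict Implicit.
Unset Printing Implicit Defensive.

Import Order.TTheory GRing.Theory Num.Theory.
Import numFieldNormedType.Exports.

Local Open Scope classical_set_scope.
Local Open Scope ring_scope.

(* A dimension d <= oo is an [option nat], with [None] standing for oo;
   indices are 0-based. *)
Definition basis_index (d : option nat) : Type :=
  if d is Some n then 'I_n else nat.

Definition is_sign (R : realType) (c : R) : Prop := c = 1 \/ c = -1.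

Definition separable_space (T : topologicalType) : Prop :=
  exists2 D : set T, countable D & dense D.

Section SequenceSpaces.
Variables (R : realType) (X : completeNormedModType R).

(* [expansion e a x] means x = sum_k a_k e_k, i.e. a is the sequence of
   coordinates of x; when d = oo the ordered series converges in norm. *)
Definition expansion (d : option nat) :
    (basis_index d -> X) -> (basis_index d -> R) -> X -> Prop :=
  match d return (basis_index d -> X) -> (basis_index d -> R) -> X -> Prop with
  | Some n => fun e a x => x = \sum_(k < n) a k *: e k
  | None => fun e a x => series (fun k => a k *: e k) @ \oo --> x
  end.

Variable d : option nat.
Implicit Type e : basis_index d -> X.

Definition schauder_basis e : Prop :=
  forall x, exists! a : basis_index d -> R, expansion e a x.

Definition one_unconditional_basis e : Prop :=
  schauder_basis e /\
  forall (x : X) (a eps : basis_index d -> R),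
    expansion e a x -> (forall k, is_sign (eps k)) ->
    exists2 y, expansion e (fun k => eps k * a k) y & `|y| = `|x|.

Definition normalized e : Prop := forall k, `|e k| = 1.

Definition strictly_monotone e : Prop :=
  forall (x y : X) (a b : basis_index d -> R),
    expansion e a x -> expansion e b y ->
    (forall k, `|a k| <= `|b k|) -> ~ (forall k, `|a k| = `|b k|) ->
    `|x| < `|y|.

(* In the next two definitions y is (sum_i |x_i|^p)^(1/p). It is the only
   element with these coordinates, and it exists because they are dominated by
   those of sum_i |x_i|, so quantifying over y universally loses nothing. *)
Definition one_convex e (p : R) : Prop :=
  forall (m : nat) (x : 'I_m -> X) (a : 'I_m -> basis_index d -> R) (y : X),
    (forall i, expansion e (a i) (x i)) ->
    expansion e (fun k => (\sum_(i < m) `|a i k| `^ p) `^ p^-1) y ->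
    `|y| <= (\sum_(i < m) `|x i| `^ p) `^ p^-1.

Definition one_concave e (q : R) : Prop :=
  forall (m : nat) (x : 'I_m -> X) (a : 'I_m -> basis_index d -> R) (y : X),
    (forall i, expansion e (a i) (x i)) ->
    expansion e (fun k => (\sum_(i < m) `|a i k| `^ q) `^ q^-1) y ->
    (\sum_(i < m) `|x i| `^ q) `^ q^-1 <= `|y|.

Definition dual_norm (f : X -> R) : R :=
  sup [set `|f x| | x in [set x : X | `|x| <= 1]].

Definition smooth_at (x : X) : Prop :=
  exists! f : X -> R^o,
    [/\ linear f, continuous f, dual_norm f = 1 & f x = `|x|].

End SequenceSpaces.

(* Main.v *)
(* Let v = U e_k and suppose that two coordinates i, j of v are nonzero. Some
   nonzero w in span (f_i, f_j) equals U x with x having e_k-coordinate 0, and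
   |v + t w| = |e_k + t x| = |v - t w| for all t. Disjointness of e_k and x gives
   |v + t w| <= (1 + t^p |x|^p)^(1/p) in the convex case, and
   |v + t w| >= (1 + t^q |x|^q)^(1/q) in the concave case.
   On the other hand, apply convexity (concavity) in Y to the pair v + t w,
   v - t w: their coordinatewise p-mean has norm at most (at least) |v + t w|.
   Since w is supported where v is nonzero, the p-mean differs from |v| by a
   quantity of exact order t^2, bounded below for p > 2 and above for q < 2; by
   strict monotonicity the norm grows at a linear rate in a nonzero coordinate.
   Hence 1 + c t^2 <= 1 + O(t^p), or 1 + c t^q <= 1 + O(t^2), which fails for
   small t. So U, and likewise its inverse, maps basis vectors to signed basis
   vectors. *)
Require Import Defs.
From HB Require Import structures.
From mathcomp Require Import all_boot all_order all_algebra.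
From mathcomp Require Import all_classical all_reals all_analysis.
From mathcomp Require Import ring lra.
Import Order.TTheory GRing.Theory Num.Theory.
Import numFieldNormedType.Exports.
Local Open Scope classical_set_scope.
Local Open Scope ring_scope.

Set Implicit Arguments.
Unset Strict Implicit.

(** * Power means of two real numbers *)

Lemma powR_midpoint (R : realType) (r x y : R) : 1 <= r -> 0 <= x -> 0 <= y ->
  ((x + y) / 2) `^ r <= (x `^ r + y `^ r) / 2.
Proof.
move=> r1 x0 y0.
have h : (0 <= (2^-1 : R) <= 1) by apply/andP; split; lra.
have := @convex_powR R r r1 (Itv01 (proj1 (andP h)) (proj2 (andP h))) x y.
rewrite !inE /= !in_itv /= !andbT => /(_ x0 y0) /=.
rewrite convRE /= => h2; apply: (le_trans (le_trans _ h2)).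
  rewrite [X in _ <= X `^ _]convRE /= /unstable.onem.
  have -> : 1 - 2^-1 = 2^-1 :> R by lra.
  by rewrite -mulrDr (mulrC 2^-1).
rewrite /unstable.onem; have -> : 1 - 2^-1 = 2^-1 :> R by lra.
by rewrite -mulrDr (mulrC 2^-1).
Qed.

Lemma powR_invK (R : realType) (p x : R) : 0 < p -> 0 <= x ->
  (x `^ p) `^ p^-1 = x.
Proof. by move=> p0 x0; rewrite -powRrM mulfV ?gt_eqF// powRr1. Qed.

Lemma powRK_inv (R : realType) (p x : R) : 0 < p -> 0 <= x ->
  (x `^ p^-1) `^ p = x.
Proof. by move=> p0 x0; rewrite -powRrM mulVf ?gt_eqF// powRr1. Qed.

(** Division by 2 makes the mean of [x] with itself [|x|], so coordinates left alone by a
    perturbation keep their modulus. *)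
Definition power_mean (R : realType) (p x y : R) : R :=
  ((`|x| `^ p + `|y| `^ p) / 2) `^ p^-1.

Lemma power_mean_ge0 (R : realType) (p x y : R) : 0 <= power_mean p x y.
Proof. exact: powR_ge0. Qed.

Lemma power_mean_xx (R : realType) (p x : R) : 0 < p -> power_mean p x x = `|x|.
Proof.
move=> p0; rewrite /power_mean mulrDl -splitr.
exact: powR_invK.
Qed.

Lemma normr_powR2 (R : realType) (p x : R) : (x ^+ 2) `^ (p / 2) = `|x| `^ p.
Proof.
rewrite -real_normK ?num_real// -powR_mulrn// -powRrM.
by congr (_ `^ _); field.
Qed.

(** Midpoint convexity of the power [p / 2] at the squares of [x + y] and [x - y], whose average is
    [x ^+ 2 + y ^+ 2]. *)
Lemma power_mean_ge (R : realType) (p x y : R) : 2 <= p ->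
  x ^+ 2 + y ^+ 2 <= power_mean p (x + y) (x - y) ^+ 2.
Proof.
move=> p2; have p0 : 0 < p by lra.
have h := @powR_midpoint R (p / 2) ((x + y) ^+ 2) ((x - y) ^+ 2).
have {h} := h _ (sqr_ge0 _) (sqr_ge0 _).
have -> : ((x + y) ^+ 2 + (x - y) ^+ 2) / 2 = x ^+ 2 + y ^+ 2 by field.
rewrite !normr_powR2 => /(_ _)/wrap[]; first by lra.
move=> h.
have s0 : 0 <= x ^+ 2 + y ^+ 2 by rewrite addr_ge0 ?sqr_ge0.
have r0 : 0 < p / 2 by rewrite divr_gt0.
have m0 := power_mean_ge0 p (x + y) (x - y).
have E : (power_mean p (x + y) (x - y) ^+ 2) `^ (p / 2) =
    (`|x + y| `^ p + `|x - y| `^ p) / 2.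
  rewrite normr_powR2 ger0_norm// /power_mean powRK_inv//.
move: h; rewrite -E leNgt => /negP h; rewrite leNgt; apply/negP => lt.
by apply: h; rewrite gt0_ltr_powR ?nnegrE ?sqr_ge0.
Qed.

(** Now [2 / q >= 1]: midpoint convexity of this power is used at the [q]-th powers of [|x + y|] and
    [|x - y|]. *)
Lemma power_mean_le (R : realType) (q x y : R) : 0 < q -> q <= 2 ->
  power_mean q (x + y) (x - y) ^+ 2 <= x ^+ 2 + y ^+ 2.
Proof.
move=> q0 q2.
have h := @powR_midpoint R (2 / q) (`|x + y| `^ q) (`|x - y| `^ q).
have {h} := h _ (powR_ge0 _ _) (powR_ge0 _ _).
rewrite -!powRrM -(mulrC (2 / q)) divfK ?gt_eqF// !powR_mulrn//.
rewrite !real_normK ?num_real//.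
have -> : ((x + y) ^+ 2 + (x - y) ^+ 2) / 2 = x ^+ 2 + y ^+ 2 by field.
move=> /(_ _)/wrap[]; first by rewrite ler_pdivlMr// mul1r.
by apply: le_trans; rewrite -powR_mulrn ?power_mean_ge0// -powRrM (mulrC q^-1).
Qed.

(** * Comparison of powers of t for small t *)

Lemma small_powR (R : realType) (r eta t0 : R) : 0 < r -> 0 < eta -> 0 < t0 ->
  exists2 t, 0 < t <= t0 & t `^ r <= eta.
Proof.
move=> r0 eta0 t00; exists (Num.min t0 (eta `^ r^-1)).
  by rewrite lt_min t00 powR_gt0// ge_min lexx.
rewrite -[leRHS](powRK_inv r0 (ltW eta0)) ge0_ler_powR ?nnegrE ?(ltW r0) ?powR_ge0//.
  by rewrite le_min (ltW t00) powR_ge0.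
by rewrite ge_min lexx orbT.
Qed.

(** Dropping the root, which only shrinks numbers at least 1, leaves [k * t ^+ 2] against C^p
    t^(p-2) t^2, and t^(p-2) tends to 0. *)
Lemma flat_not_quadratic (R : realType) (p C k t0 : R) :
  2 < p -> 0 <= C -> 0 < k -> 0 < t0 ->
  ~ forall t, 0 < t <= t0 -> 1 + k * t ^+ 2 <= (1 + (t * C) `^ p) `^ p^-1.
Proof.
move=> p2 C0 k0 t00 H.
have p0 : 0 < p by lra.
have Cp0 := powR_ge0 C p.
have D0 : 0 < C `^ p + 1 by lra.
(* This bound forces C^p t^(p-2) <= k/2; the [+ 1] keeps the denominator positive when [C = 0]. *)
have [||t /andP[t1 t2] h] := @small_powR R (p - 2) (k / 2 / (C `^ p + 1)) t0 _ _ t00.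
- lra.
- by rewrite !divr_gt0.
have := H t; rewrite t1 t2 => /(_ isT).
rewrite leNgt => /negP; apply.
have s0 := powR_ge0 (t * C) p.
apply: (@le_lt_trans _ _ (1 + (t * C) `^ p)).
  rewrite ler1_powR ?lerDl//.
  by rewrite invf_le1//; lra.
rewrite ltrD2l powRM ?(ltW t1)//.
have -> : t `^ p = t `^ (p - 2) * t ^+ 2.
  rewrite -(powR_mulrn 2 (ltW t1)) -powRD ?subrK//.
  by rewrite (gt_eqF t1) implybT.
rewrite mulrAC ltr_pM2r ?exprn_gt0//.
move: h; rewrite ler_pdivlMr// => h.
have := powR_ge0 t (p - 2); nra.
Qed.

(** For t <= 1, (1 + H t^2)^q <= (1 + H t^2)^2 <= 1 + (2H + H^2) t^2. Writing t^2 = t^(2-q) t^q,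
    this falls below 1 + C^q t^q once t^(2-q) is small. *)
Lemma cusp_not_quadratic (R : realType) (q C H : R) :
  0 < q -> q < 2 -> 0 < C -> 0 <= H ->
  ~ forall t, 0 < t -> (1 + (t * C) `^ q) `^ q^-1 <= 1 + H * t ^+ 2.
Proof.
move=> q0 q2 C0 H0 Hyp.
have Cq0 := powR_gt0 q C0.
have D0 : 0 < 2 * H + H ^+ 2 + 1 by nra.
have [||t /andP[t1 t2] h] := @small_powR R (2 - q)
  (C `^ q / 2 / (2 * H + H ^+ 2 + 1)) 1 _ _ ltr01.
- lra.
- by rewrite !divr_gt0.
have := Hyp t t1.
rewrite leNgt => /negP; apply.
have s0 := powR_ge0 (t * C) q.
have b1 : 1 <= 1 + H * t ^+ 2 by rewrite lerDl mulr_ge0// sqr_ge0.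
rewrite -[ltLHS](@powR_invK R q)//; last by lra.
rewrite gt0_ltr_powR ?invr_gt0 ?nnegrE ?powR_ge0//; first by lra.
apply: (@le_lt_trans _ _ ((1 + H * t ^+ 2) ^+ 2)).
  by rewrite -powR_mulrn ?ler_powR//; lra.
apply: (@le_lt_trans _ _ (1 + (2 * H + H ^+ 2) * t ^+ 2)).
  have t21 : t ^+ 2 <= 1 by rewrite expr_le1// ltW.
  have : 0 <= H ^+ 2 * t ^+ 2 * (1 - t ^+ 2).
    by apply: mulr_ge0; rewrite ?subr_ge0// mulr_ge0 ?sqr_ge0.
  nra.
rewrite ltrD2l powRM ?(ltW t1) ?(ltW C0)//.
have -> : t ^+ 2 = t `^ (2 - q) * t `^ q.
  rewrite -(powR_mulrn 2 (ltW t1)) -powRD ?subrK//.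
  by rewrite (gt_eqF t1) implybT.
rewrite mulrA [ltRHS]mulrC ltr_pM2r ?powR_gt0//.
move: h; rewrite ler_pdivlMr// => h.
have := powR_ge0 t (2 - q); nra.
Qed.

(** * Quadratic bounds for the mean of [x + y] and [x - y] *)

Lemma power_mean_ge_normr (R : realType) (p x y : R) : 2 <= p ->
  `|x| <= power_mean p (x + y) (x - y).
Proof.
move=> p2; rewrite -(@ler_pXn2r _ 2) ?nnegrE ?power_mean_ge0//.
rewrite real_normK ?num_real//.
by apply: le_trans (power_mean_ge _ _ p2); rewrite lerDl sqr_ge0.
Qed.

(** Squaring the left side adds 2y^2/3 plus a term at most y^2/9 (as [|y| <= |x|]) to x^2; the
    factor 3 keeps this total below y^2. *)
Lemma power_mean_ge_quadratic (R : realType) (p x y : R) : 2 <= p -> x != 0 ->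
  `|y| <= `|x| -> `|x| + y ^+ 2 / (3 * `|x|) <= power_mean p (x + y) (x - y).
Proof.
move=> p2; rewrite -normr_gt0 => x0 yx.
have y2 : y ^+ 2 <= `|x| ^+ 2.
  by rewrite -(real_normK (num_real y)) ler_pXn2r ?nnegrE.
have D0 : 0 <= y ^+ 2 / (3 * `|x|) by rewrite divr_ge0 ?sqr_ge0// mulr_ge0.
rewrite -(@ler_pXn2r _ 2) ?nnegrE ?power_mean_ge0 ?addr_ge0//.
apply: le_trans (power_mean_ge _ _ p2).
rewrite -[in leRHS](real_normK (num_real x)) sqrrD.
have -> : `|x| * (y ^+ 2 / (3 * `|x|)) = y ^+ 2 / 3 by field; rewrite gt_eqF.
have : (y ^+ 2 / (3 * `|x|)) ^+ 2 <= y ^+ 2 / 9.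
  have -> : (y ^+ 2 / (3 * `|x|)) ^+ 2 = y ^+ 2 / 9 * (y ^+ 2 / `|x| ^+ 2).
    by field; rewrite gt_eqF.
  by rewrite ler_piMr ?divr_ge0 ?sqr_ge0// ler_pdivrMr ?mul1r ?exprn_gt0.
have := sqr_ge0 y; lra.
Qed.

(** The square of the right side is at least x^2 + 2y^2, more than the x^2 + y^2 of
    [power_mean_le]. *)
Lemma power_mean_le_quadratic (R : realType) (q x y : R) : 0 < q -> q <= 2 ->
  x != 0 -> power_mean q (x + y) (x - y) <= `|x| + y ^+ 2 / `|x|.
Proof.
move=> q0 q2; rewrite -normr_gt0 => x0.
have D0 : 0 <= y ^+ 2 / `|x| by rewrite divr_ge0 ?sqr_ge0.
rewrite -(@ler_pXn2r _ 2) ?nnegrE ?power_mean_ge0 ?addr_ge0//.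
apply: le_trans (power_mean_le _ _ q0 q2) _.
rewrite -[in leLHS](real_normK (num_real x)) sqrrD.
have -> : `|x| * (y ^+ 2 / `|x|) = y ^+ 2 by field; rewrite gt_eqF.
have := sqr_ge0 y; have := sqr_ge0 (y ^+ 2 / `|x|); lra.
Qed.

(** * Calculus of coordinate expansions *)

Lemma expansionD (R : realType) (X : completeNormedModType R) (d : option nat)
    (e : basis_index d -> X) (a b : basis_index d -> R) (x y : X) :
  expansion e a x -> expansion e b y ->
  expansion e (fun k => a k + b k) (x + y).
Proof.
case: d e a b => [n|] e a b /= ea eb.
  by rewrite ea eb -big_split; apply: eq_bigr => k _; rewrite scalerDl.
have -> : (fun k => (a k + b k) *: e k) =
    (fun k => a k *: e k) + (fun k => b k *: e k).
  by apply/funext => k; rewrite scalerDl.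
by rewrite seriesD; apply: cvgD.
Qed.

Lemma expansion_linear (R : realType) (X Y : completeNormedModType R)
    (d : option nat) (e : basis_index d -> X) (a : basis_index d -> R) (x : X)
    (U : {linear X -> Y}) : continuous U ->
  expansion e a x -> expansion (fun k => U (e k)) a (U x).
Proof.
move=> cU; case: d e a => [n|] e a /= ea.
  by rewrite ea linear_sum; apply: eq_bigr => k _; rewrite linearZ.
have -> : series (fun k => a k *: U (e k)) = U \o series (fun k => a k *: e k).
  apply/funext => n; rewrite /series /= linear_sum.
  by apply: eq_bigr => k _; rewrite linearZ.
exact: (continuous_cvg _ (cU x)).
Qed.

Lemma expansionZ (R : realType) (X : completeNormedModType R) (d : option nat)
    (e : basis_index d -> X) (a : basis_index d -> R) (x : X) (c : R) :
  expansion e a x -> expansion e (fun k => c * a k) (c *: x).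
Proof.
case: d e a => [n|] e a /= ea.
  by rewrite ea scaler_sumr; apply: eq_bigr => k _; rewrite scalerA.
have -> : (fun k => (c * a k) *: e k) = (fun k => c *: (a k *: e k)).
  by apply/funext => k; rewrite scalerA.
have -> : series (fun k => c *: (a k *: e k)) =
    c \*: series (fun k => a k *: e k).
  by apply/funext => n; rewrite /series /= scaler_sumr.
by apply: cvgZl_tmp.
Qed.

Lemma expansion_scale_basis (R : realType) (X : completeNormedModType R)
    (d : option nat) (e : basis_index d -> X) (s a : basis_index d -> R) (x : X) :
  expansion (fun k => s k *: e k) a x -> expansion e (fun k => s k * a k) x.
Proof.
case: d e s a => [n|] e s a /= ea.
  by rewrite ea; apply: eq_bigr => k _; rewrite scalerA mulrC.
have -> // : (fun k => (s k * a k) *: e k) = (fun k => a k *: (s k *: e k)).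
by apply/funext => k; rewrite scalerA mulrC.
Qed.

(** Equality is decided classically because [basis_index d] does not reduce for a variable [d]. *)
Definition unit_coord (R : realType) (d : option nat) (k l : basis_index d) : R :=
  if `[< l = k >] then 1 else 0.

Lemma unit_coord_id (R : realType) (d : option nat) (k : basis_index d) :
  unit_coord R k k = 1.
Proof. by rewrite /unit_coord asboolT. Qed.

Lemma unit_coord_neq (R : realType) (d : option nat) (k l : basis_index d) :
  l <> k -> unit_coord R k l = 0.
Proof. by move=> ?; rewrite /unit_coord asboolF. Qed.

Lemma expansion_basis (R : realType) (X : completeNormedModType R)
    (d : option nat) (e : basis_index d -> X) (k : basis_index d) :
  expansion e (unit_coord R k) (e k).
Proof.
case: d e k => [n|] e k /=.
  rewrite (bigD1 k)//= unit_coord_id scale1r big1 ?addr0// => i /eqP ik.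
  by rewrite unit_coord_neq// scale0r.
(* A partial sum of length n contains index k exactly when n > k; from there on the sums are
   constant. *)
apply: cvg_near_cst; exists k.+1 => // n /= kn.
rewrite /series /= (bigD1_seq k)/= ?iota_uniq ?mem_index_iota//.
rewrite (@unit_coord_id R None) scale1r big1 ?addr0// => i /eqP ik.
by rewrite (@unit_coord_neq R None)// scale0r.
Qed.

Lemma expansion_inj (R : realType) (X : completeNormedModType R)
    (d : option nat) (e : basis_index d -> X) (a : basis_index d -> R) (x y : X) :
  expansion e a x -> expansion e a y -> x = y.
Proof.
case: d e a => [n|] e a /=; first by move=> -> ->.
exact: norm_cvg_unique.
Qed.

Lemma coord_unique (R : realType) (X : completeNormedModType R)
    (d : option nat) (e : basis_index d -> X) (a b : basis_index d -> R) (x : X) :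
  schauder_basis e -> expansion e a x -> expansion e b x -> a = b.
Proof. by move=> /(_ x)[c [_ cu]] ea eb; rewrite -(cu a ea) -(cu b eb). Qed.

(** * The norm as a function of the moduli of coordinates *)

Lemma expansion_abs (R : realType) (X : completeNormedModType R)
    (d : option nat) (e : basis_index d -> X) (a : basis_index d -> R) (x : X) :
  one_unconditional_basis e -> expansion e a x ->
  exists2 y, expansion e (fun k => `|a k|) y & `|y| = `|x|.
Proof.
move=> [_ unc] ea.
have [k|y ey yx] := unc x a (fun k => if 0 <= a k then 1 else -1) ea.
  by case: ifP => _; [left|right].
exists y => //; congr (expansion e _ y): ey; apply/funext => k.
case: ifPn => [a0|]; first by rewrite mul1r ger0_norm.
by rewrite -ltNge => a0; rewrite mulN1r ltr0_norm.
Qed.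

Lemma norm_eq_abs (R : realType) (X : completeNormedModType R)
    (d : option nat) (e : basis_index d -> X) (a b : basis_index d -> R)
    (x y : X) : one_unconditional_basis e ->
  expansion e a x -> expansion e b y -> (forall k, `|a k| = `|b k|) ->
  `|x| = `|y|.
Proof.
move=> unc ea eb ab.
have [x' ex' <-] := expansion_abs unc ea.
have [y' ey' <-] := expansion_abs unc eb.
have E : (fun k => `|a k|) = (fun k => `|b k|) by apply/funext.
by rewrite E in ex'; rewrite (expansion_inj ex' ey').
Qed.

(** Strict monotonicity covers only differing moduli; unconditionality handles equal ones. *)
Lemma norm_le_abs (R : realType) (X : completeNormedModType R)
    (d : option nat) (e : basis_index d -> X) (a b : basis_index d -> R)
    (x y : X) : one_unconditional_basis e -> strictly_monotone e ->
  expansion e a x -> expansion e b y -> (forall k, `|a k| <= `|b k|) ->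
  `|x| <= `|y|.
Proof.
move=> unc mono ea eb ab; have [eqab|neq] := pselect (forall k, `|a k| = `|b k|).
  by rewrite (norm_eq_abs unc ea eb eqab).
exact: ltW (mono _ _ _ _ ea eb ab neq).
Qed.

Lemma expansion_update (R : realType) (X : completeNormedModType R)
    (d : option nat) (e : basis_index d -> X) (a b : basis_index d -> R)
    (x : X) (i : basis_index d) :
  expansion e a x -> (forall l, l <> i -> b l = a l) ->
  expansion e b (x + (b i - a i) *: e i).
Proof.
move=> ea ab.
have := expansionD ea (expansionZ (b i - a i) (expansion_basis e i)).
congr (expansion e _ _); apply/funext => l.
have [->|li] := pselect (l = i); first by rewrite unit_coord_id mulr1 addrC subrK.
by rewrite unit_coord_neq// mulr0 addr0 ab.
Qed.

(** Convexity of the norm on a line: [x] lies between [x + s *: e i] and the vector [y] with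
    coordinate [i] erased, and [|y| < |x|]. The slope from [y] to [x] serves as [k]. *)
Lemma strict_growth (R : realType) (X : completeNormedModType R)
    (d : option nat) (e : basis_index d -> X) (a : basis_index d -> R)
    (x : X) (i : basis_index d) : strictly_monotone e ->
  expansion e a x -> 0 < a i ->
  exists2 k : R, 0 < k &
    forall s, 0 <= s -> `|x| + k * s <= `|x + s *: e i|.
Proof.
move=> mono ea ai0.
set y := x - a i *: e i.
have ey : expansion e (fun l => a l + - a i * unit_coord R i l) y.
  by rewrite /y -scaleNr; exact: expansionD ea (expansionZ _ (expansion_basis e i)).
have yx : `|y| < `|x|.
  apply: (mono _ _ _ _ ey ea) => [l|/(_ i)].
    have [->|li] := pselect (l = i); last by rewrite unit_coord_neq// mulr0 addr0.
    by rewrite unit_coord_id mulr1 subrr normr0.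
  by rewrite unit_coord_id mulr1 subrr normr0 => /esym/normr0_eq0 ai; rewrite ai ltxx in ai0.
exists ((`|x| - `|y|) / a i); first by rewrite divr_gt0// subr_gt0.
move=> s s0.
have E : (a i + s) *: x = a i *: (x + s *: e i) + s *: y.
  by rewrite /y scalerDr scalerBr !scalerA (mulrC s) scalerDl addrACA subrr addr0.
have : (a i + s) * `|x| <= a i * `|x + s *: e i| + s * `|y|.
  have nZ (c : R) (z : X) : 0 <= c -> c * `|z| = `|c *: z|.
    by move=> c0; rewrite normrZ ger0_norm.
  rewrite !nZ ?addr_ge0 ?(ltW ai0)// E; exact: ler_normD.
move=> h; rewrite -(ler_pM2l ai0) mulrDr mulrA [a i * (_ / _)]mulrC divfK ?gt_eqF//; nra.
Qed.

(** When d = oo not every sequence is a coordinate sequence; altering two entries of one that is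
    causes no loss. *)
Lemma expansion_update2 (R : realType) (X : completeNormedModType R)
    (d : option nat) (e : basis_index d -> X) (a b : basis_index d -> R)
    (x : X) (i j : basis_index d) :
  expansion e a x -> (forall l, l <> i -> l <> j -> b l = a l) ->
  exists y, expansion e b y.
Proof.
move=> ea ab; pose a' l := if `[< l = i >] then b l else a l.
have ea' : expansion e a' (x + (a' i - a i) *: e i).
  by apply: expansion_update ea _ => l li; rewrite /a' asboolF.
eexists; apply: (expansion_update (i := j) ea') => l lj; rewrite /a'.
by have [->|li] := pselect (l = i); [rewrite asboolT|rewrite asboolF// ab].
Qed.

(** * Convexity and concavity for two vectors *)

Lemma one_convex2 (R : realType) (X : completeNormedModType R)
    (d : option nat) (e : basis_index d -> X) (p : R)
    (a b c : basis_index d -> R) (x y z : X) :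
  one_convex e p -> expansion e a x -> expansion e b y -> expansion e c z ->
  (forall k, c k = (`|a k| `^ p + `|b k| `^ p) `^ p^-1) ->
  `|z| <= (`|x| `^ p + `|y| `^ p) `^ p^-1.
Proof.
move=> conv ea eb ec cE.
have := conv 2%N (fun i => if i == ord0 then x else y)
  (fun i => if i == ord0 then a else b) z.
rewrite !big_ord_recl big_ord0 /= addr0; apply; first by move=> i; case: ifP.
congr (expansion e _ z): ec; apply/funext => k.
by rewrite cE !big_ord_recl big_ord0 /= addr0.
Qed.

Lemma one_concave2 (R : realType) (X : completeNormedModType R)
    (d : option nat) (e : basis_index d -> X) (q : R)
    (a b c : basis_index d -> R) (x y z : X) :
  one_concave e q -> expansion e a x -> expansion e b y -> expansion e c z ->
  (forall k, c k = (`|a k| `^ q + `|b k| `^ q) `^ q^-1) ->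
  (`|x| `^ q + `|y| `^ q) `^ q^-1 <= `|z|.
Proof.
move=> conc ea eb ec cE.
have := conc 2%N (fun i => if i == ord0 then x else y)
  (fun i => if i == ord0 then a else b) z.
rewrite !big_ord_recl big_ord0 /= addr0; apply; first by move=> i; case: ifP.
congr (expansion e _ z): ec; apply/funext => k.
by rewrite cE !big_ord_recl big_ord0 /= addr0.
Qed.

Lemma normr_disjoint_powR (R : realType) (p x y : R) : 0 < p ->
  x = 0 \/ y = 0 -> `|x + y| = (`|x| `^ p + `|y| `^ p) `^ p^-1.
Proof.
move=> p0 [->|->]; rewrite ?add0r ?addr0 normr0 powR0 ?gt_eqF//.
  by rewrite add0r powR_invK.
by rewrite addr0 powR_invK.
Qed.

(** On disjoint supports the coordinatewise p-sum is the modulus of [x + y], so convexity becomes an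
    upper p-estimate. *)
Lemma one_convex_disjoint (R : realType) (X : completeNormedModType R)
    (d : option nat) (e : basis_index d -> X) (p : R)
    (a b : basis_index d -> R) (x y : X) :
  one_unconditional_basis e -> 0 < p -> one_convex e p ->
  expansion e a x -> expansion e b y -> (forall k, a k = 0 \/ b k = 0) ->
  `|x + y| <= (`|x| `^ p + `|y| `^ p) `^ p^-1.
Proof.
move=> unc p0 conv ea eb ab; have [z ez <-] := expansion_abs unc (expansionD ea eb).
by apply: one_convex2 conv ea eb ez _ => k; exact: normr_disjoint_powR.
Qed.

Lemma one_concave_disjoint (R : realType) (X : completeNormedModType R)
    (d : option nat) (e : basis_index d -> X) (q : R)
    (a b : basis_index d -> R) (x y : X) :
  one_unconditional_basis e -> 0 < q -> one_concave e q ->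
  expansion e a x -> expansion e b y -> (forall k, a k = 0 \/ b k = 0) ->
  (`|x| `^ q + `|y| `^ q) `^ q^-1 <= `|x + y|.
Proof.
move=> unc q0 conc ea eb ab; have [z ez <-] := expansion_abs unc (expansionD ea eb).
by apply: one_concave2 conc ea eb ez _ => k; exact: normr_disjoint_powR.
Qed.

Lemma power_mean_scaled (R : realType) (p x y : R) :
  2 `^ p^-1 * power_mean p x y = (`|x| `^ p + `|y| `^ p) `^ p^-1.
Proof.
rewrite /power_mean -powRM ?divr_ge0 ?addr_ge0 ?powR_ge0//.
by rewrite mulrC divfK.
Qed.

Lemma powR_double (R : realType) (p x : R) : 0 < p -> 0 <= x ->
  (x `^ p + x `^ p) `^ p^-1 = 2 `^ p^-1 * x.
Proof.
move=> p0 x0; have -> : x `^ p + x `^ p = 2 * x `^ p by ring.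
by rewrite powRM ?powR_ge0// powR_invK.
Qed.

(** With equal norms, both sides of the convexity inequality carry the factor 2^(1/p), which
    cancels. *)
Lemma one_convex_mean (R : realType) (X : completeNormedModType R)
    (d : option nat) (e : basis_index d -> X) (p : R)
    (a b c : basis_index d -> R) (x y z : X) : 0 < p -> one_convex e p ->
  expansion e a x -> expansion e b y -> expansion e c z ->
  (forall k, c k = power_mean p (a k) (b k)) -> `|y| = `|x| -> `|z| <= `|x|.
Proof.
move=> p0 conv ea eb ec cE yx.
have two0 : 0 < (2 : R) `^ p^-1 by rewrite powR_gt0.
have := one_convex2 conv ea eb (expansionZ (2 `^ p^-1) ec).
rewrite yx powR_double// normrZ (gtr0_norm two0).
by rewrite ler_pM2l//; apply => k; rewrite cE power_mean_scaled.
Qed.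

Lemma one_concave_mean (R : realType) (X : completeNormedModType R)
    (d : option nat) (e : basis_index d -> X) (q : R)
    (a b c : basis_index d -> R) (x y z : X) : 0 < q -> one_concave e q ->
  expansion e a x -> expansion e b y -> expansion e c z ->
  (forall k, c k = power_mean q (a k) (b k)) -> `|y| = `|x| -> `|x| <= `|z|.
Proof.
move=> q0 conc ea eb ec cE yx.
have two0 : 0 < (2 : R) `^ q^-1 by rewrite powR_gt0.
have := one_concave2 conc ea eb (expansionZ (2 `^ q^-1) ec).
rewrite yx powR_double// normrZ (gtr0_norm two0).
by rewrite ler_pM2l//; apply => k; rewrite cE power_mean_scaled.
Qed.

(** * Perturbations supported on two coordinates *)

Lemma expansion_power_mean (R : realType) (Y : completeNormedModType R)
    (d : option nat) (f : basis_index d -> Y) (p t : R)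
    (a g : basis_index d -> R) (u : Y) (i j : basis_index d) : 0 < p ->
  expansion f (fun l => `|a l|) u ->
  (forall l, l <> i -> l <> j -> g l = 0) ->
  exists z, expansion f (fun l => power_mean p (a l + t * g l) (a l - t * g l)) z.
Proof.
(* Outside [i] and [j] the mean is [|a l|], so it alters [u] in at most two places and does
   represent an element. *)
move=> p0 eu supp; apply: (expansion_update2 (i := i) (j := j) eu) => l li lj.
by rewrite (supp l li lj) mulr0 subr0 addr0 power_mean_xx.
Qed.

(** The p-mean of [v + t *: w] and [v - t *: w] dominates |v| + h t^2 f_i coordinatewise, and
    [strict_growth] turns this into norm at least 1 + k h t^2. *)
Lemma convex_perturbation (R : realType) (Y : completeNormedModType R)
    (d : option nat) (f : basis_index d -> Y) (p C : R)
    (a g : basis_index d -> R) (v w : Y) (i j : basis_index d) :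
  one_unconditional_basis f -> strictly_monotone f ->
  2 < p -> one_convex f p -> 0 <= C ->
  expansion f a v -> expansion f g w -> `|v| = 1 ->
  a i != 0 -> g i != 0 -> (forall l, l <> i -> l <> j -> g l = 0) ->
  (forall t, `|v - t *: w| = `|v + t *: w|) ->
  ~ forall t, 0 < t -> `|v + t *: w| <= (1 + (t * C) `^ p) `^ p^-1.
Proof.
move=> unc mono p2 conv C0 ev ew v1 ai gi supp sym H.
have p0 : 0 < p by lra.
have [u eu uv] := expansion_abs unc ev; rewrite v1 in uv.
have ai0 : 0 < `|a i| by rewrite normr_gt0.
have gi0 : 0 < `|g i| by rewrite normr_gt0.
have [k k0 grow] := strict_growth mono eu ai0.
pose h := g i ^+ 2 / (3 * `|a i|).
have h0 : 0 < h by apply: divr_gt0; [rewrite exprn_even_gt0|exact: mulr_gt0].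
(* The range of t is the one where [|t * g i| <= |a i|], as the quadratic lower bound requires. *)
apply: (@flat_not_quadratic R p C (k * h) (`|a i| / `|g i|)) => //.
- exact: mulr_gt0.
- exact: divr_gt0.
move=> t /andP[t0]; rewrite ler_pdivlMr// => tg.
apply: le_trans (H t t0).
have [z ez] := expansion_power_mean t p0 eu supp.
have evp := expansionD ev (expansionZ t ew).
have evm := expansionD ev (expansionZ (- t) ew); rewrite scaleNr in evm.
have zle : `|z| <= `|v + t *: w|.
  by apply: one_convex_mean p0 conv evp evm ez _ (sym t) => l; rewrite mulNr.
apply: le_trans zle.
have s0 : 0 <= h * t ^+ 2 by rewrite mulr_ge0 ?sqr_ge0// ltW.
rewrite -mulrA -[1]uv; apply: le_trans (grow _ s0) _.
apply: norm_le_abs unc mono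
  (expansionD eu (expansionZ (h * t ^+ 2) (expansion_basis f i))) ez _ => l.
rewrite [leRHS]ger0_norm ?power_mean_ge0//.
have [->|li] := pselect (l = i); last first.
  rewrite unit_coord_neq// mulr0 addr0 normr_id.
  exact: power_mean_ge_normr (ltW p2).
rewrite unit_coord_id mulr1 ger0_norm ?addr_ge0//.
have -> : h * t ^+ 2 = (t * g i) ^+ 2 / (3 * `|a i|) by rewrite /h exprMn; ring.
by apply: power_mean_ge_quadratic (ltW p2) ai _; rewrite normrM gtr0_norm.
Qed.

(** Both [a i] and [a j] must be nonzero here: every coordinate where [w] may live has to move only
    quadratically, by at most [h l * t ^+ 2]. *)
Lemma concave_perturbation (R : realType) (Y : completeNormedModType R)
    (d : option nat) (f : basis_index d -> Y) (q C : R)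
    (a g : basis_index d -> R) (v w : Y) (i j : basis_index d) :
  one_unconditional_basis f -> strictly_monotone f -> normalized f ->
  0 < q -> q < 2 -> one_concave f q -> 0 < C ->
  expansion f a v -> expansion f g w -> `|v| = 1 ->
  a i != 0 -> a j != 0 -> (forall l, l <> i -> l <> j -> g l = 0) ->
  (forall t, `|v - t *: w| = `|v + t *: w|) ->
  ~ forall t, 0 < t -> (1 + (t * C) `^ q) `^ q^-1 <= `|v + t *: w|.
Proof.
move=> unc mono nf q0 q2 conc C0 ev ew v1 ai aj supp sym H.
have [u eu uv] := expansion_abs unc ev; rewrite v1 in uv.
pose h l := g l ^+ 2 / `|a l|.
have h0 l : 0 <= h l by rewrite divr_ge0 ?sqr_ge0.
apply: (@cusp_not_quadratic R q C (h i + h j)) => //; first exact: addr_ge0.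
move=> t t0; apply: le_trans (H t t0) _.
have [z ez] := expansion_power_mean t q0 eu supp.
have evp := expansionD ev (expansionZ t ew).
have evm := expansionD ev (expansionZ (- t) ew); rewrite scaleNr in evm.
have zge : `|v + t *: w| <= `|z|.
  by apply: one_concave_mean q0 conc evp evm ez _ (sym t) => l; rewrite mulNr.
apply: le_trans zge _.
have s0 l : 0 <= h l * t ^+ 2 by rewrite mulr_ge0 ?sqr_ge0.
have D0 (l m : basis_index d) : 0 <= h l * t ^+ 2 * unit_coord R l m.
  by rewrite mulr_ge0// /unit_coord; case: ifP.
have bd : `|z| <= `|u + (h i * t ^+ 2) *: f i + (h j * t ^+ 2) *: f j|.
  apply: norm_le_abs unc mono ez (expansionD
    (expansionD eu (expansionZ (h i * t ^+ 2) (expansion_basis f i)))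
    (expansionZ (h j * t ^+ 2) (expansion_basis f j))) _ => l.
  rewrite ger0_norm ?power_mean_ge0// [leRHS]ger0_norm ?addr_ge0//.
  have quad : a l != 0 -> power_mean q (a l + t * g l) (a l - t * g l) <=
      `|a l| + h l * t ^+ 2.
    move=> al; rewrite (le_trans (power_mean_le_quadratic _ q0 (ltW q2) al))//.
    by have -> : h l * t ^+ 2 = (t * g l) ^+ 2 / `|a l| by rewrite /h exprMn; ring.
  have [li|li] := pselect (l = i).
    rewrite -addrA (le_trans (quad _)) ?li//.
    by rewrite lerD2l unit_coord_id mulr1 lerDl.
  have [lj|lj] := pselect (l = j).
    rewrite -addrA (le_trans (quad _)) ?lj//.
    by rewrite lerD2l unit_coord_id mulr1 lerDr.
  by rewrite (supp l li lj) mulr0 addr0 subr0 power_mean_xx// -addrA lerDl addr_ge0.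
(* The triangle inequality with [f i] and [f j] of norm one bounds the norm by 1 + (h_i + h_j)
   t^2. *)
apply: (le_trans bd); apply: le_trans (ler_normD _ _) _.
rewrite mulrDl addrA lerD//; last by rewrite normrZ nf mulr1 ger0_norm.
apply: le_trans (ler_normD _ _) _.
by rewrite uv lerD// normrZ nf mulr1 ger0_norm.
Qed.

(** * Images of basis vectors under an isometry *)

(** [U] is a plain function with linearity as a hypothesis, so that the lemma also applies to an
    inverse obtained by choice. *)
Lemma isometry_basis (R : realType) (d : option nat)
    (X Y : completeNormedModType R) (e : basis_index d -> X) (f : basis_index d -> Y)
    (U : X -> Y) :
  one_unconditional_basis e -> one_unconditional_basis f ->
  normalized e -> normalized f -> strictly_monotone f ->
  (exists p : R, [/\ 2 < p, one_convex e p & one_convex f p]) \/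
  (exists q : R, [/\ 0 < q, q < 2, one_concave e q & one_concave f q]) ->
  linear U -> (forall x, `|U x| = `|x|) -> (forall y, exists x, U x = y) ->
  forall k, exists i, exists2 s : R, is_sign s & U (e k) = s *: f i.
Proof.
move=> unce uncf ne nf mono hab linU isoU surU k.
have UD x y : U (x + y) = U x + U y by rewrite -[x in LHS]scale1r linU scale1r.
have U0 : U 0 = 0 by apply/eqP; rewrite -normr_eq0 isoU normr0.
have UZ c x : U (c *: x) = c *: U x by rewrite -[_ *: x]addr0 linU U0 addr0.
have [a [ea _]] := uncf.1 (U (e k)).
have v1 : `|U (e k)| = 1 by rewrite isoU ne.
have [i ai] : exists i, a i != 0.
  apply: contrapT => /forallNP az.
  (* A zero sequence is 0 times itself, so it expands both [U (e k)] and 0. *)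
  have a0 : a = (fun l => 0 * a l).
    by apply/funext => l; rewrite mul0r; apply: contrapT => /eqP; exact: az.
  have := expansionZ 0 ea; rewrite -a0 scale0r => /(expansion_inj ea) v0.
  by move: v1; rewrite v0 normr0 => /esym/eqP; rewrite oner_eq0.
exists i; have [[j [ji aj]]|single] := pselect (exists j, j <> i /\ a j != 0); last first.
  have aE : a = (fun l => a i * unit_coord R i l).
    apply/funext => l; have [->|li] := pselect (l = i).
      by rewrite unit_coord_id mulr1.
    rewrite unit_coord_neq// mulr0; apply: contrapT => /eqP al.
    by apply: single; exists l.
  have UE : U (e k) = a i *: f i.
    apply: expansion_inj ea _; rewrite {1}aE.
    exact: expansionZ (expansion_basis f i).
  exists (a i) => //; move: v1; rewrite UE normrZ nf mulr1 => /eqP.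
  by rewrite eqr_norml ler01 andbT => /orP[]/eqP->; [left|right].
exfalso.
have [xi Uxi] := surU (f i); have [xj Uxj] := surU (f j).
have [bi [ebi _]] := unce.1 xi; have [bj [ebj _]] := unce.1 xj.
(* One homogeneous equation in two unknowns has a nontrivial solution; it makes the preimage [x] of
   [w] vanish at coordinate [k]. *)
have [c [c' [cc' cb]]] : exists c c' : R,
    (c != 0 \/ c' != 0) /\ c * bi k + c' * bj k = 0.
  have [bi0|bi0] := eqVneq (bi k) 0.
    by exists 1, 0; rewrite bi0 mulr0 mul0r addr0 oner_neq0; split=> //; left.
  by exists (bj k), (- bi k); rewrite oppr_eq0; split; [right|ring].
pose x := c *: xi + c' *: xj; pose w := c *: f i + c' *: f j.
have Ux : U x = w by rewrite UD !UZ Uxi Uxj.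
pose b l := c * bi l + c' * bj l.
have ex : expansion e b x by exact: expansionD (expansionZ c ebi) (expansionZ c' ebj).
pose g l := c * unit_coord R i l + c' * unit_coord R j l.
have ew : expansion f g w.
  exact: expansionD (expansionZ c (expansion_basis f i))
    (expansionZ c' (expansion_basis f j)).
have gi : g i = c by rewrite /g unit_coord_id unit_coord_neq ?mulr0 ?addr0 ?mulr1// => /esym.
have gj : g j = c' by rewrite /g unit_coord_id unit_coord_neq// mulr0 add0r mulr1.
have supp l : l <> i -> l <> j -> g l = 0.
  by move=> li lj; rewrite /g !unit_coord_neq// !mulr0 addr0.
have disj t l : unit_coord R k l = 0 \/ t * b l = 0.
  have [->|lk] := pselect (l = k); first by right; rewrite /b cb mulr0.
  by left; exact: unit_coord_neq.
have UE t : `|U (e k) + t *: w| = `|e k + t *: x| by rewrite -isoU UD UZ Ux.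
(* In X the two vectors differ only by signs off coordinate [k]; the isometry carries equality of
   norms to Y. *)
have sym t : `|U (e k) - t *: w| = `|U (e k) + t *: w|.
  rewrite -scaleNr !UE; apply: (norm_eq_abs unce
    (expansionD (expansion_basis e k) (expansionZ (- t) ex))
    (expansionD (expansion_basis e k) (expansionZ t ex))) => l.
  by rewrite mulNr; case: (disj t l) => ->; rewrite ?add0r ?normrN ?subr0 ?addr0.
have nx t : 0 < t -> `|t *: x| = t * `|x| by move=> t0; rewrite normrZ gtr0_norm.
have x0 : 0 < `|x|.
  rewrite normr_gt0; apply/eqP => x0.
  have gE : g = (fun l => 0 * g l).
    apply: (coord_unique uncf.1 ew); rewrite -Ux x0 U0 -(scale0r w).
    exact: expansionZ.
  by case: cc'; [rewrite -gi|rewrite -gj]; rewrite gE mul0r eqxx.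
case: hab => [[p [p2 conve convf]]|[q [q0 q2 conce concf]]].
  have p0 : 0 < p by lra.
  have H t : 0 < t -> `|U (e k) + t *: w| <= (1 + (t * `|x|) `^ p) `^ p^-1.
    move=> t0; rewrite UE -nx//.
    have := one_convex_disjoint unce p0 conve (expansion_basis e k)
      (expansionZ t ex) (disj t).
    by rewrite ne powR1.
  (* The convex argument needs a coordinate where [w] is nonzero: [i] if c is nonzero, otherwise [j]
     with the roles exchanged. *)
  case: cc' => c0.
    by apply: (convex_perturbation (i := i) (j := j) uncf mono p2 convf (ltW x0)
      ea ew v1 ai _ supp sym H); rewrite gi.
  apply: (convex_perturbation (i := j) (j := i) uncf mono p2 convf (ltW x0)
    ea ew v1 aj _ _ sym H); first by rewrite gj.
  by move=> l lj li; exact: supp.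
apply: (concave_perturbation uncf mono nf q0 q2 concf x0 ea ew v1 ai aj supp sym).
move=> t t0; rewrite UE -nx//.
have := one_concave_disjoint unce q0 conce (expansion_basis e k)
  (expansionZ t ex) (disj t).
by rewrite ne powR1.
Qed.

(** * Assembly of the permutation and the signs *)

Unset Implicit Arguments.

Theorem theorem9 (R : realType) (d : option nat)
    (X Y : completeNormedModType R) (e : basis_index d -> X) (f : basis_index d -> Y)
    (hd : if d is Some n then (3 <= n)%N else true)
    (sepX : separable_space X) (sepY : separable_space Y)
    (basX : one_unconditional_basis e) (basY : one_unconditional_basis f)
    (normX : normalized e) (normY : normalized f)
    (monoX : strictly_monotone e) (monoY : strictly_monotone f)
    (hab : (exists p : R, [/\ 2 < p, one_convex e p & one_convex f p]) \/
           ((exists q : R,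
               [/\ 1 < q, q < 2, one_concave e q & one_concave f q]) /\
            (forall k, smooth_at (e k)) /\ (forall k, smooth_at (f k))))
    (U : {linear X -> Y}) (isoU : forall x, `|U x| = `|x|)
    (surjU : forall y, exists x, U x = y) :
  exists (sigma : basis_index d -> basis_index d) (eps : basis_index d -> R),
    [/\ bijective sigma, forall k, is_sign (eps k) &
        forall (x : X) (a : basis_index d -> R), expansion e a x ->
          expansion (fun k => f (sigma k)) (fun k => eps k * a k) (U x)].
Proof.
have hab1 : (exists p : R, [/\ 2 < p, one_convex e p & one_convex f p]) \/
    (exists q : R, [/\ 0 < q, q < 2, one_concave e q & one_concave f q]).
  case: hab => [|[[q [q1 q2 qe qf]] _]]; [by left|right; exists q].
  by split=> //; exact: lt_trans q1.
have hab2 : (exists p : R, [/\ 2 < p, one_convex f p & one_convex e p]) \/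
    (exists q : R, [/\ 0 < q, q < 2, one_concave f q & one_concave e q]).
  by case: hab1 => [[p []]|[q []]]; [left; exists p|right; exists q].
have [V VK] := choice surjU.
have injU x y : U x = U y -> x = y.
  move=> /eqP; rewrite -subr_eq0 -linearB -normr_eq0 isoU normr_eq0 subr_eq0.
  by move=> /eqP.
have UK x : V (U x) = x by apply: injU; rewrite VK.
have linV : linear V by move=> c x y; apply: injU; rewrite linearP !VK.
have isoV y : `|V y| = `|y| by rewrite -isoU VK.
have [sigma sigmaP] := choice (isometry_basis basX basY normX normY monoY hab1
  (@linearP _ _ _ _ U) isoU surjU).
have [tau tauP] := choice (isometry_basis basY basX normY normX monoX hab2
  linV isoV (fun x => ex_intro _ (U x) (UK x))).
have [eps epsS Ue] : exists2 eps : basis_index d -> R,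
    forall k, is_sign (eps k) & forall k, U (e k) = eps k *: f (sigma k).
  have /choice[eps epsP] : forall k, exists s : R,
      is_sign s /\ U (e k) = s *: f (sigma k).
    by move=> k; have [s ? ?] := sigmaP k; exists s.
  by exists eps => k; have [] := epsP k.
(* Proportional basis vectors have the same index: compare coordinates at [k]. *)
have basis_inj (Z : completeNormedModType R) (h : basis_index d -> Z) (c : R) k l :
    schauder_basis h -> h k = c *: h l -> k = l.
  move=> bash hkl; apply: contrapT => kl.
  have := expansionZ c (expansion_basis h l); rewrite -hkl.
  move=> /(coord_unique bash (expansion_basis h k))/(congr1 (@^~ k)).
  by rewrite unit_coord_id unit_coord_neq// mulr0 => /eqP; rewrite oner_eq0.
exists sigma, eps; split=> //.
  (* Applying U to V f_(sigma k) = s e_(tau (sigma k)) makes [U (e k)] a multiple of U e_(tau (sigma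
     k)); injectivity of U then gives equal indices. *)
  exists tau => k.
    have [s _] := tauP (sigma k).
    move=> /(congr1 U); rewrite VK linearZ => fE.
    apply/esym/(basis_inj X e (eps k * s)); first exact: basX.1.
    by apply: injU; rewrite Ue linearZ /= -scalerA -fE.
  (* Likewise [f k] is a multiple of f_(sigma (tau k)). *)
  have [s _] := tauP k.
  move=> /(congr1 U); rewrite VK linearZ /= Ue scalerA.
  by move=> /(basis_inj Y f _ _ _ basY.1).
move=> x a ea.
(* Continuity lets U pass through the infinite sum; the signs then move from the vectors [U (e k)]
   to the coordinates. *)
have cU : continuous U.
  apply: bounded_linear_continuous; apply/linear_boundedP.
  by exists 1; split=> // M M1 z; rewrite isoU ler_peMl// ltW.
apply: expansion_scale_basis; have := expansion_linear cU ea.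
by congr (expansion _ a (U x)); apply/funext.
Qed.
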